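(* The parity family $\mathrm{PAR}=(\mathrm{PAR}_n)_{n\in\mathbb{N}}$ belongs to $\mathrm{IS}^0{:}B(5n-2)$; that is, there is $h:\mathbb{N}\to\mathbb{N}$ and $m\in\mathbb{N}$ with $h(n)\le 5n-2$ for all $n\ge m$, such that for every $n\in\mathbb{N}$ some instruction sequence using no auxiliary registers computes $\mathrm{PAR}_n$ and has length at most $h(n)$.
   Context: Booleans are $\mathrm{F}$ and $\mathrm{T}$. An instruction sequence is a finite sequence $u_1;u_2;\dots;u_k$ of primitive instructions; its length is $k$. Basic instructions are: $\mathrm{in}{:}i.\mathrm{get}$ ($i\ge1$), $\mathrm{out}.\mathrm{set}{:}b$ ($b\in\{\mathrm{F},\mathrm{T}\}$), $\mathrm{aux}{:}i.\mathrm{get}$, $\mathrm{aux}{:}i.\mathrm{set}{:}b$, $\mathrm{aux}{:}i.\mathrm{com}$ ($i\ge1$). Each names a Boolean register ($\mathrm{in}{:}i$ input, $\mathrm{out}$ output, $\mathrm{aux}{:}i$ auxiliary) and a command: $\mathrm{get}$ leaves the register unchanged and replies its content; $\mathrm{set}{:}b$ sets the content to $b$ and replies $b$; $\mathrm{com}$ complements the content and replies the new content. Primitive instructions: for each basic instruction $a$, plain $a$, positive test ${+}a$, negative test ${-}a$; forward jumps $\#l$ ($l\in\mathbb{N}$); termination $!$. Execution starts at $u_1$. ${+}a$ executes $a$ and proceeds with the next instruction if the reply is $\mathrm{T}$, otherwise skips the next instruction and proceeds with the one after; ${-}a$ likewise with replies reversed; plain $a$ executes $a$ and proceeds with the next instruction;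 $\#l$ proceeds with the $l$th next instruction; $!$ terminates. If $l=0$ or there is no instruction to proceed with, inaction occurs (no termination). $X$ computes $f:\{\mathrm{F},\mathrm{T}\}^n\to\{\mathrm{F},\mathrm{T}\}$ if there is $k\in\mathbb{N}$ (at least every auxiliary index used in $X$) such that for all $b_1,\dots,b_n$: starting with $\mathrm{in}{:}i$ containing $b_i$, $\mathrm{out}$ containing $\mathrm{F}$, and $\mathrm{aux}{:}1,\dots,\mathrm{aux}{:}k$ containing $\mathrm{F}$, execution terminates with $\mathrm{out}$ containing $f(b_1,\dots,b_n)$. $\mathrm{IS}^k$ denotes the set of instruction sequences in which no instruction of the form $\mathrm{aux}{:}i.c$, ${+}\mathrm{aux}{:}i.c$, ${-}\mathrm{aux}{:}i.c$ with $i>k$ occurs; so $\mathrm{IS}^0$ uses no auxiliary registers. For a set $\mathcal{I}$ of instruction sequences and $f:\mathbb{N}\to\mathbb{N}$, $\mathcal{I}{:}B(f(n))$ is the class of Boolean function families $(f_n)_{n\in\mathbb{N}}$ ($f_n$ $n$-ary) for which there exists $h:\mathbb{N}\to\mathbb{N}$ with $h(n)\le f(n)$ for all sufficiently large $n$ such that for all $n$ there is $X\in\mathcal{I}$ computing $f_n$ with length at most $h(n)$. $\mathrm{PAR}_n(b_1,\dots,b_n)=\mathrm{T}$ iff the number of $\mathrm{T}$'s among $b_1,\dots,b_n$ is odd. *)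

(* Defs.v *)
From mathcomp Require Import all_boot.

Set Implicit Arguments.
Unset Strict Implicit.
Unset Printing Implicit Defensive.

Definition reg_index : Type := {i : nat | 0 < i}.

Inductive command : Type :=
| Get
| SetTo of bool
| Com.

Inductive basic : Type :=
| InGet of reg_index
| OutSet of bool
| Aux of reg_index & command.

Inductive instr : Type :=
| Plain of basic
| PosTest of basic
| NegTest of basic
| Jump of nat
| Halt.

(* Every command replies the content that it leaves in the register, so a
   single function gives both the reply and the new content. *)
Definition apply_command (c : command) (b : bool) : bool :=
  match c with
  | Get => b
  | SetTo b' => b'
  | Com => ~~ b
  end.

(* Register i of a family is stored at position i.-1; a position beyond the
   end of the sequence is a register that does not exist. *)
Record state : Type := State {
  inputs : seq bool;
  output : bool;
  auxs : seq bool
}.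

(* The reply and the resulting state; None if the register does not exist, in
   which case inaction occurs. *)
Definition exec_basic (a : basic) (s : state) : option (bool * state) :=
  match a with
  | InGet i =>
      if onth (inputs s) (sval i).-1 is Some b then Some (b, s) else None
  | OutSet b => Some (b, State (inputs s) b (auxs s))
  | Aux i c =>
      if onth (auxs s) (sval i).-1 is Some b then
        let r := apply_command c b in
        Some (r, State (inputs s) (output s)
                       (set_nth false (auxs s) (sval i).-1 r))
      else None
  end.

(* [terminates X s s'] : execution from the first instruction of X in state s
   terminates in state s'. As jumps are forward, X is the part of the
   instruction sequence from the current instruction on. Inaction is the absence
   of a derivation: there is no rule for [::] or for Jump 0. *)
Inductive terminates : seq instr -> state -> state -> Prop :=
| TermHalt X s :
    terminates (Halt :: X) s s
| TermPlain a X s r s1 s' :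
    exec_basic a s = Some (r, s1) ->
    terminates X s1 s' ->
    terminates (Plain a :: X) s s'
| TermPosTest a X s r s1 s' :
    exec_basic a s = Some (r, s1) ->
    terminates (if r then X else drop 1 X) s1 s' ->
    terminates (PosTest a :: X) s s'
| TermNegTest a X s r s1 s' :
    exec_basic a s = Some (r, s1) ->
    terminates (if r then drop 1 X else X) s1 s' ->
    terminates (NegTest a :: X) s s'
| TermJump l X s s' :
    terminates (drop l X) s s' ->
    terminates (Jump l.+1 :: X) s s'.

Definition aux_le_basic (k : nat) (a : basic) : bool :=
  if a is Aux i _ then sval i <= k else true.

Definition aux_le (k : nat) (u : instr) : bool :=
  match u with
  | Plain a | PosTest a | NegTest a => aux_le_basic k a
  | Jump _ | Halt => true
  end.

Definition IS (k : nat) (X : seq instr) : Prop := all (aux_le k) X.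

Definition computes (n : nat) (X : seq instr) (f : n.-tuple bool -> bool) : Prop :=
  exists k : nat, IS k X /\
    forall b : n.-tuple bool, exists s' : state,
      terminates X (State b false (nseq k false)) s' /\ output s' = f b.

Definition boolean_family : Type := forall n : nat, n.-tuple bool -> bool.

(* [in_B I f g] : the family g belongs to the class I:B(f(n)). *)
Definition in_B (I : seq instr -> Prop) (f : nat -> nat) (g : boolean_family) : Prop :=
  exists h : nat -> nat,
    (exists m : nat, forall n : nat, m <= n -> h n <= f n) /\
    forall n : nat, exists X : seq instr,
      [/\ I X, computes X (g n) & size X <= h n].

Definition PAR : boolean_family := fun n b => odd (count_mem true b).

Arguments PAR : clear implicits.

(* Main.v *)
Require Import Defs.
From mathcomp Require Import all_boot.

(** The parity of the bits read so far is kept in the program counter. Each bit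
    but the first is read by a block with two entry points, at offset 0 (even so
    far) and offset 3 (odd so far). Since one exit of the odd half falls through
    to the even entry of the next block, an inner block takes 5 instructions;
    the last block takes 6, because it sets the output and terminates in place.
    The first bit only has the even half, of which one exit falls through, so 2
    instructions suffice: 2 + 5 (n - 2) + 6 = 5 n - 2. *)

Definition in_get (i : nat) : basic := InGet (exist _ i.+1 (ltn0Sn i)).

(* Reads the inputs at positions i, ..., i + m. *)
Fixpoint parity_blocks (i m : nat) : seq instr :=
  if m is m'.+1 then
    [:: PosTest (in_get i), Jump 7, Jump 3, NegTest (in_get i), Jump 4
      & parity_blocks i.+1 m']
  else
    [:: PosTest (in_get i); Plain (OutSet true); Halt;
        NegTest (in_get i); Plain (OutSet true); Halt].

Definition parity_program (n : nat) : seq instr :=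
  match n with
  | 0 => [:: Halt]
  | 1 => [:: PosTest (in_get 0); Plain (OutSet true); Halt]
  | m.+2 => [:: PosTest (in_get 0), Jump 4 & parity_blocks 1 m]
  end.

Lemma exec_in_get (pre bs : seq bool) (x o : bool) (aux : seq bool) :
  exec_basic (in_get (size pre)) (State (pre ++ x :: bs) o aux) =
  Some (x, State (pre ++ x :: bs) o aux).
Proof. by rewrite /= onth_cat ltnn subnn. Qed.

(** Generalised for the induction: [pre] holds the bits already read; [p], in use their parity,
    selects the entry point. *)
Lemma parity_blocks_terminates (bs pre : seq bool) (x p : bool) (aux : seq bool) :
  terminates (drop (if p then 3 else 0) (parity_blocks (size pre) (size bs)))
    (State (pre ++ x :: bs) false aux)
    (State (pre ++ x :: bs) (p (+) odd (count_mem true (x :: bs))) aux).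
Proof.
elim: bs pre x p => [|y bs IH] pre x p.
  by case: p; case: x; (apply: TermPosTest || apply: TermNegTest);
    rewrite ?exec_in_get //=; repeat econstructor.
have := IH (rcons pre x) y (p (+) x).
rewrite size_rcons cat_rcons.
have -> : p (+) x (+) odd (count_mem true (y :: bs)) =
          p (+) odd (count_mem true [:: x, y & bs]).
  by rewrite [count_mem _ (x :: _)]/= oddD -addbA; case: x.
move=> {}IH.
(* One case per exit: [Jump 7] and [Jump 4] reach offset 3 of the next block, [Jump 3] and the
   fall-through offset 0. *)
by case: p IH; case: x => /= IH; (apply: TermPosTest || apply: TermNegTest);
  rewrite ?exec_in_get //=; rewrite ?drop0 in IH *;
  do ?[apply: TermJump => /=; rewrite ?drop0].
Qed.

Lemma parity_program_terminates (b aux : seq bool) :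
  terminates (parity_program (size b)) (State b false aux)
    (State b (odd (count_mem true b)) aux).
Proof.
case: b => [|x [|y bs]]; first exact: TermHalt.
  by case: x; apply: TermPosTest => //=; repeat econstructor.
(* After one bit the parity is [x] itself. *)
have /= := parity_blocks_terminates bs [:: x] y x aux.
by case: x => /= IH; apply: TermPosTest => //=; rewrite ?drop0 in IH *;
  do ?[apply: TermJump => /=].
Qed.

Lemma parity_blocks_IS0 (i m : nat) : IS 0 (parity_blocks i m).
Proof. by elim: m i => [|m IH] i //=; apply: IH. Qed.

Lemma parity_program_IS0 (n : nat) : IS 0 (parity_program n).
Proof. by case: n => [|[|m]] //; apply: parity_blocks_IS0. Qed.

Lemma size_parity_blocks (i m : nat) : size (parity_blocks i m) = 5 * m + 6.
Proof. by elim: m i => [|m IH] i //=; rewrite IH mulnS. Qed.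

Lemma size_parity_program (n : nat) : 0 < n -> size (parity_program n) = 5 * n - 2.
Proof.
by case: n => [|[|m]] //= _; rewrite size_parity_blocks !mulnS [5 * m + 6]addnC.
Qed.

Theorem theorem1 : in_B (IS 0) (fun n : nat => 5 * n - 2) PAR.
Proof.
exists (fun n => size (parity_program n)); split.
  (* At [n = 0] the program has length 1, while the truncated [5 * 0 - 2] is 0. *)
  by exists 1 => n n_gt0; rewrite size_parity_program.
move=> n; exists (parity_program n); split=> //; first exact: parity_program_IS0.
exists 0; split=> [|b]; first exact: parity_program_IS0.
exists (State b (PAR n b) [::]); split=> //.
by rewrite -[in parity_program n](size_tuple b); apply: parity_program_terminates.
Qed.
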